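(* The $3$-fold injective tensor product $\ell_1 \widehat{\otimes}_\varepsilon \ell_1 \widehat{\otimes}_\varepsilon \ell_1$ is not isomorphic to any subspace of the $2$-fold injective tensor product $\ell_1 \widehat{\otimes}_\varepsilon \ell_1$.
   Context: Banach spaces are over the real scalars, and $\ell_1$ is the Banach space of absolutely summable sequences indexed by $\mathbb{N}$ with its usual norm. For a Banach space $X$ and $n\in\mathbb{N}$, the $n$-fold injective tensor product $\widehat{\otimes}_\varepsilon^n X = X\widehat{\otimes}_\varepsilon\cdots\widehat{\otimes}_\varepsilon X$ is the completion of the algebraic tensor product of $n$ copies of $X$ under the norm $\|u\|_\varepsilon=\sup\{|\langle f_1\otimes\cdots\otimes f_n,u\rangle| : f_1,\ldots,f_n\in X^*,\ \|f_i\|\leqslant 1\}$. ''Isomorphic'' means linearly homeomorphic (not necessarily isometric). *)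

(* Defs.v *)
From HB Require Import structures.
From mathcomp Require Import all_boot all_order all_algebra.
From mathcomp Require Import all_classical all_reals all_analysis.
From mathcomp Require Import lra.
Set Implicit Arguments.
Unset Strict Implicit.
Unset Printing Implicit Defensive.
Import Order.TTheory GRing.Theory Num.Theory.
Import numFieldNormedType.Exports.
Local Open Scope classical_set_scope.
Local Open Scope ring_scope.

Lemma complete_of_seq (R : realType) (V : normedModType R) :
  (forall u : nat -> V,
     (forall e : R, 0 < e -> exists N, forall m n : nat,
        (N <= m)%N -> (N <= n)%N -> `|u m - u n| < e) ->
     cvgn u) ->
  forall F : set_system V, ProperFilter F -> cauchy F -> cvg F.
Proof.
move=> cV F FF /cauchyP Fc.
have /choice[u Fu] (n : nat) : exists x, F (ball x (n.+1%:R^-1 : R)).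
  by apply: Fc; rewrite invr_gt0.
have close m n : `|u m - u n| < m.+1%:R^-1 + n.+1%:R^-1 :> R.
  have [z []] := filter_ex (filterI (Fu m) (Fu n)).
  rewrite -!ball_normE /ball_ /= => zm zn.
  have <- : (u m - z) - (u n - z) = u m - u n.
    by rewrite opprB addrA subrK.
  by rewrite (le_lt_trans (ler_normB _ _))// ltrD.
have inve (e : R) : 0 < e -> exists N : nat, forall n, (N <= n)%N ->
    n.+1%:R^-1 < e.
  move=> e0; have [N _ HN] := near_infty_natSinv_lt (PosNum e0).
  by exists N => n /HN.
have uc e : 0 < e -> exists N, forall m n : nat,
    (N <= m)%N -> (N <= n)%N -> `|u m - u n| < e.
  move=> e0; have [N HN] := inve (e / 2) (divr_gt0 e0 (ltr0Sn _ 1)).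
  exists N => m n Nm Nn; apply: (lt_trans (close m n)).
  by rewrite [ltRHS](splitr e) ltrD ?HN.
have /cvg_ex[l ul] := cV u uc.
apply/cvg_ex; exists l; apply/cvgrPdist_lt => e e0.
have [N HN] := inve (e / 2) (divr_gt0 e0 (ltr0Sn _ 1)).
have [M _ HM] : \forall n \near \oo, `|l - u n| < e / 2.
  by move/cvgrPdist_lt : ul; apply; rewrite divr_gt0.
apply: filterS (Fu (maxn N M)) => x; rewrite -ball_normE/= => ux.
rewrite -(subrK (u (maxn N M)) l) -addrA (le_lt_trans (ler_normD _ _))//.
rewrite [ltRHS](splitr e) ltrD//; first by apply: HM => /=; exact: leq_maxr.
by apply: (lt_trans ux); apply: HN; exact: leq_maxl.
Qed.

Section l1.
Variable R : realType.

Definition l1_pred : {pred nat -> R} :=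
  [pred u : nat -> R | `[< cvgn [normed series u] >] ].

Lemma l1_submod_closed : submod_closed l1_pred.
Proof.
split=> [|a u v /asboolP cu /asboolP cv]; apply/asboolP.
  rewrite (_ : [normed series _] = cst 0); first exact: is_cvg_cst.
  apply/funext => n; rewrite /= seriesEnat/=; by rewrite big1// => i _; rewrite normr0.
apply: (@series_le_cvg _ _ (fun n => `|a| * `|u n| + `|v n|)).
- by move=> n /=.
- by move=> n /=; rewrite addr_ge0// mulr_ge0.
- by move=> n /=; rewrite (le_trans (ler_normD _ _))// normrM.
- exact: (is_cvg_seriesD (is_cvg_seriesZ (k := `|a|) cu) cv).
Qed.

HB.instance Definition _ :=
  GRing.isSubmodClosed.Build R (nat -> R) l1_pred l1_submod_closed.

Record l1 := MkL1 { l1_val :> nat -> R; _ : l1_val \in l1_pred }.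

HB.instance Definition _ := [isSub for l1_val].
HB.instance Definition _ := [Choice of l1 by <:].
HB.instance Definition _ := [SubChoice_isSubLmodule of l1 by <:].

Definition l1_norm (u : l1) : R := limn [normed series (u : nat -> R)].

Lemma l1_cvg (u : l1) : cvgn [normed series (u : nat -> R)].
Proof. by case: u => u /= /asboolP. Qed.

Lemma l1_normD (u v : l1) : l1_norm (u + v) <= l1_norm u + l1_norm v.
Proof.
rewrite /l1_norm -lim_seriesD; [|exact: l1_cvg..].
apply: lim_series_le; [exact: l1_cvg| |by move=> n /=; exact: ler_normD].
by apply: is_cvg_seriesD; exact: l1_cvg.
Qed.

Lemma l1_normZ (a : R) (u : l1) : l1_norm (a *: u) = `|a| * l1_norm u.
Proof.
apply: etrans (lim_seriesZ `|a| (@l1_cvg u)).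
by congr (limn (series _)); apply/funext => n /=; rewrite normrM.
Qed.

Lemma normed_seriesE (u : nat -> R) n :
  [normed series u] n = \sum_(0 <= k < n) `|u k|.
Proof. by []. Qed.

Lemma nondecreasing_normed_series (u : nat -> R) :
  {homo [normed series u] : m n / (m <= n)%N >-> m <= n}.
Proof. by move=> m n mn; rewrite !normed_seriesE; apply: nondecreasing_series. Qed.

Lemma l1_norm_ge (u : l1) n : [normed series (u : nat -> R)] n <= l1_norm u.
Proof.
apply: nondecreasing_cvgn_le; last exact: l1_cvg.
exact: nondecreasing_normed_series.
Qed.

Lemma l1_coord_le (u : l1) n : `|u n| <= l1_norm u.
Proof.
apply: le_trans (l1_norm_ge u n.+1).
by rewrite normed_seriesE big_nat_recr//= lerDr sumr_ge0.
Qed.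

Lemma l1_norm_eq0 (u : l1) : l1_norm u = 0 -> u = 0.
Proof.
move=> u0; apply: val_inj; apply/funext => n /=; apply/normr0_eq0/eqP.
by rewrite eq_le normr_ge0 andbT -u0 l1_coord_le.
Qed.

HB.instance Definition _ :=
  Lmodule_isNormed.Build R l1 l1_normD l1_normZ l1_norm_eq0.

Lemma l1_complete (F : set_system l1) :
  ProperFilter F -> cauchy F -> cvg F.
Proof.
apply: complete_of_seq => u uc.
have cc k : cvgn (fun n => u n k).
  apply/cauchy_cvgP/cauchyP => e e0; have [N HN] := uc e e0.
  exists (u N k); exists N => // n /= Nn; rewrite -ball_normE /ball_ /=.
  by apply: le_lt_trans (HN N n (leqnn N) Nn); exact: (l1_coord_le (u N - u n)).
pose l (k : nat) : R := limn (fun n => u n k).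
have tail e : 0 < e -> exists N, forall n, (N <= n)%N -> forall K,
    \sum_(0 <= k < K) `|u n k - l k| <= e.
  move=> e0; have [N HN] := uc e e0; exists N => n Nn K.
  have cs : (\sum_(0 <= k < K) `|u n k - u m k|) @[m --> \oo] -->
            \sum_(0 <= k < K) `|u n k - l k|.
    apply: cvg_big => [|k _]; [exact: add_continuous|]; apply: cvg_norm; apply: cvgB; first exact: cvg_cst.
    exact: cc.
  rewrite -(cvg_lim _ cs)//; apply: limr_le; first exact: (cvgP _ cs).
  exists N => // m /= Nm; apply: ltW; apply: le_lt_trans (HN n m Nn Nm).
  exact: (l1_norm_ge (u n - u m)).
have lP : l \in l1_pred.
  apply/asboolP; have [N HN] := tail 1 ltr01.
  apply: nondecreasing_is_cvgn; first exact: nondecreasing_normed_series.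
  exists (1 + `|u N|) => _ [K _ <-] /=.
  apply: le_trans (lerD (HN N (leqnn _) K) (l1_norm_ge (u N) K)).
  rewrite !normed_seriesE -big_split/=; apply: ler_sum => k _.
  by rewrite -(normrN (u N k - l k)) opprB -{1}(subrK (u N k) (l k)) ler_normD.
apply/cvg_ex; exists (MkL1 lP); apply/cvgrPdist_le => e e0.
have [N HN] := tail e e0; exists N => // n /= Nn; rewrite distrC.
apply: limr_le; first exact: l1_cvg.
by apply: nearW => K; exact: HN.
Qed.

HB.instance Definition _ := Uniform_isComplete.Build l1 l1_complete.

End l1.

Section algebraic_tensor_power.
Variables (R : realType) (n : nat) (X : lmodType R).

Definition multilinear (B : ('I_n -> X) -> R) :=
  forall (x : 'I_n -> X) (i : 'I_n), scalar (fun y : X => B (dfwith x i y)).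

Definition mform := {B : ('I_n -> X) -> R | multilinear B}.

(* Following R. Ryan, Introduction to Tensor Products of Banach Spaces, the
   algebraic tensor power is the span, among the functions on the space of all
   (not necessarily continuous) multilinear forms, of the evaluations
   x_1 (x) ... (x) x_n : B |-> B (x_1, ..., x_n). *)
Definition elem_tensor (x : 'I_n -> X) : mform -> R := fun B => sval B x.

Definition tensor_pred : {pred mform -> R} :=
  [pred u : mform -> R | `[< exists s : seq (R * ('I_n -> X)),
     u = \sum_(t <- s) t.1 *: elem_tensor t.2 >] ].

Lemma tensor_submod_closed : submod_closed tensor_pred.
Proof.
split=> [|a u v /asboolP[s ->] /asboolP[t ->]]; apply/asboolP.
  by exists [::]; rewrite big_nil.
exists ([seq (a * p.1, p.2) | p <- s] ++ t); rewrite big_cat/= big_map/=.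
by rewrite scaler_sumr; congr (_ + _); apply: eq_bigr => p _; rewrite scalerA.
Qed.

HB.instance Definition _ :=
  GRing.isSubmodClosed.Build R (mform -> R) tensor_pred tensor_submod_closed.

Record tensor := MkTensor {
  tensor_val :> mform -> R; _ : tensor_val \in tensor_pred }.

HB.instance Definition _ := [isSub for tensor_val].
HB.instance Definition _ := [Choice of tensor by <:].
HB.instance Definition _ := [SubChoice_isSubLmodule of tensor by <:].

Lemma elem_tensor_in x : elem_tensor x \in tensor_pred.
Proof.
by apply/asboolP; exists [:: (1, x)]; rewrite big_seq1 scale1r.
Qed.

Definition pure_tensor (x : 'I_n -> X) : tensor := MkTensor (elem_tensor_in x).

Lemma pure_tensor_multilinear x i (a : R) (y z : X) :
  pure_tensor (dfwith x i (a *: y + z)) =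
  a *: pure_tensor (dfwith x i y) + pure_tensor (dfwith x i z).
Proof. by apply/val_inj/funext => B; exact: (svalP B x i a y z). Qed.

Lemma tensorP (u : tensor) : exists s : seq (R * ('I_n -> X)),
  u = \sum_(t <- s) t.1 *: pure_tensor t.2.
Proof.
case: (u) => v /= /[dup] /asboolP[s vE] vP; exists s.
by apply: val_inj; rewrite raddf_sum/=.
Qed.

Lemma tensor_sumE (s : seq (R * ('I_n -> X))) (B : mform) :
  (\sum_(t <- s) t.1 *: pure_tensor t.2 : tensor) B = \sum_(t <- s) t.1 * sval B t.2.
Proof.
rewrite -[LHS]/(val (\sum_(t <- s) t.1 *: pure_tensor t.2) B) raddf_sum/= fct_sumE.
by [].
Qed.

(* [form_tensor f] is f_1 (x) ... (x) f_n seen as a multilinear form, so that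
   the pairing < f_1 (x) ... (x) f_n, u > is [u (form_tensor f)]. *)
Lemma form_tensor_subproof (f : 'I_n -> {linear X -> R^o}) :
  multilinear (fun x => \prod_(i < n) f i (x i)).
Proof.
move=> x i a y z.
have E w : \prod_(j < n) f j (dfwith x i w j) =
    f i w * \prod_(j < n | j != i) f j (x j) :> R.
  rewrite (bigD1 i)//= dfwithin; congr (_ * _).
  by apply: eq_bigr => j ji; rewrite dfwithout// eq_sym.
by rewrite /= !E linearP/= mulrDl mulrA.
Qed.

Definition form_tensor (f : 'I_n -> {linear X -> R^o}) : mform :=
  exist _ _ (form_tensor_subproof f).

End algebraic_tensor_power.

Section seminorm.
Variables (R : realType) (E : lmodType R).

Record seminorm := Seminorm {
  seminorm_fun :> E -> R;
  seminormD : forall x y, seminorm_fun (x + y) <= seminorm_fun x + seminorm_fun y;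
  seminormZ : forall a x, seminorm_fun (a *: x) = `|a| * seminorm_fun x }.

Variable p : seminorm.

Lemma seminorm0 : p 0 = 0.
Proof. by rewrite -[X in p X](scale0r 0) seminormZ normr0 mul0r. Qed.

Lemma seminormN x : p (- x) = p x.
Proof. by rewrite -scaleN1r seminormZ normrN1 mul1r. Qed.

Lemma seminorm_ge0 x : 0 <= p x.
Proof.
have := seminormD p x (- x); rewrite subrr seminorm0 seminormN.
by rewrite -mulr2n pmulrn_lge0.
Qed.

Lemma seminormB x y : p (x - y) = p (y - x).
Proof. by rewrite -opprB seminormN. Qed.

Lemma seminorm_dist x y : `|p x - p y| <= p (x - y).
Proof.
rewrite ler_norml; apply/andP; split.
  by rewrite lerNl opprB lerBlDr seminormB -{1}(subrK x y) seminormD.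
by rewrite lerBlDr -{1}(subrK y x) seminormD.
Qed.

End seminorm.

Section injective_norm.
Variables (R : realType) (n : nat) (X : normedModType R).

Definition dual_norm (f : {linear X -> R^o}) : \bar R :=
  ereal_sup [set `|f x|%:E | x in [set x : X | `|x| <= 1]].

Definition dual_ball : set {linear X -> R^o} :=
  [set f : {linear X -> R^o} | continuous f /\ (dual_norm f <= 1)%E].

Definition inj_norm (u : tensor n X) : R :=
  sup [set `|u (form_tensor f)| |
       f in [set f : 'I_n -> {linear X -> R^o} | forall i, dual_ball (f i)]].

Let inj_set (u : tensor n X) : set R := [set `|u (form_tensor f)| |
       f in [set f : 'I_n -> {linear X -> R^o} | forall i, dual_ball (f i)]].

(* The set of values defining [inj_norm] is nonempty and bounded above (see
   [inj_set0] and [inj_set_ub] below), so its real-valued sup is the true one. *)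
Lemma dual_ball_le f x : dual_ball f -> `|f x| <= `|x|.
Proof.
move=> [_ f1]; have [->|x0] := eqVneq x 0; first by rewrite linear0 !normr0.
have nx : 0 < `|x| by rewrite normr_gt0.
have : (`|f (`|x|^-1 *: x)|%:E <= 1)%E.
  apply: le_trans f1; apply: ereal_sup_ubound; exists (`|x|^-1 *: x) => //=.
  by rewrite normrZ gtr0_norm ?invr_gt0// mulVf// gt_eqF.
rewrite lee_fin linearZ/= normrM gtr0_norm ?invr_gt0//.
by rewrite ler_pdivrMl// mulr1.
Qed.

Lemma dual_ball0 : dual_ball \0.
Proof.
split; first by move=> x; exact: cvg_cst.
by apply: ge_ereal_sup => _ [x _ <-] /=; rewrite normr0 lee_fin.
Qed.

Lemma inj_set0 u : inj_set u !=set0.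
Proof.
by exists `|u (form_tensor (fun=> \0))|; exists (fun=> \0) => // i; exact: dual_ball0.
Qed.

Lemma inj_set_ub u : has_ubound (inj_set u).
Proof.
have [s ->] := tensorP u.
exists (\sum_(t <- s) `|t.1| * \prod_(i < n) `|t.2 i|) => _ [f f1 <-].
rewrite tensor_sumE; apply: le_trans (ler_norm_sum _ _ _) _.
apply: ler_sum => t _; rewrite normrM ler_wpM2l//= normr_prod.
by apply: ler_prod => i _; rewrite normr_ge0 dual_ball_le.
Qed.

Lemma inj_norm_ge (u : tensor n X) f : (forall i, dual_ball (f i)) ->
  `|u (form_tensor f)| <= inj_norm u.
Proof. by move=> f1; apply: (ub_le_sup (inj_set_ub u)); exists f. Qed.

Lemma inj_normD (u v : tensor n X) : inj_norm (u + v) <= inj_norm u + inj_norm v.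
Proof.
apply: ge_sup; first exact: inj_set0.
move=> _ [f f1 <-]; apply: le_trans (ler_normD _ _) _.
by rewrite lerD// inj_norm_ge.
Qed.

Lemma inj_normZ_le (a : R) (u : tensor n X) : inj_norm (a *: u) <= `|a| * inj_norm u.
Proof.
apply: ge_sup; first exact: inj_set0.
move=> _ [f f1 <-].
by rewrite -[X in `|X|]/(a * u (form_tensor f)) normrM ler_wpM2l// inj_norm_ge.
Qed.

Lemma inj_normZ (a : R) (u : tensor n X) : inj_norm (a *: u) = `|a| * inj_norm u.
Proof.
apply/eqP; rewrite eq_le inj_normZ_le/=.
have [->|a0] := eqVneq a 0.
  rewrite normr0 mul0r; have [f f1] := inj_set0 (0 *: u).
  by apply: le_trans (ub_le_sup (inj_set_ub _) f1); case: f1 => g _ <-.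
have := inj_normZ_le a^-1 (a *: u).
by rewrite scalerA mulVf// scale1r normfV ler_pdivlMl ?normr_gt0.
Qed.

(* By the Hahn-Banach theorem [inj_norm] is even a norm. Definiteness is not
   needed here because [completion] identifies points at distance zero. *)
Definition inj_seminorm : seminorm (tensor n X) :=
  Seminorm inj_normD inj_normZ.

End injective_norm.

Section completion.
Variables (R : realType) (E : lmodType R) (p : seminorm E).

Definition cauchy_pred : {pred nat -> E} :=
  [pred u : nat -> E | `[< forall e : R, 0 < e -> exists N, forall m n : nat,
     (N <= m)%N -> (N <= n)%N -> p (u m - u n) < e >] ].

Lemma cauchy_submod_closed : submod_closed cauchy_pred.
Proof.
split=> [|a u v /asboolP cu /asboolP cv]; apply/asboolP => e e0.
  by exists 0%N => m n _ _; rewrite subr0 seminorm0.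
have a1 : 0 < `|a| + 1 by rewrite ltr_wpDl.
have [N HN] := cu (e / 2 / (`|a| + 1)) (divr_gt0 (divr_gt0 e0 (ltr0Sn _ 1)) a1).
have [M HM] := cv (e / 2) (divr_gt0 e0 (ltr0Sn _ 1)).
exists (maxn N M) => m n; rewrite !geq_max => /andP[Nm Mm] /andP[Nn Mn].
rewrite -[X in p X]/(a *: u m + v m - (a *: u n + v n)) opprD addrACA -scalerBr.
apply: le_lt_trans (seminormD _ _ _) _; rewrite seminormZ [ltRHS](splitr e).
apply: ler_ltD; last exact: HM.
apply: (@le_trans _ _ ((`|a| + 1) * p (u m - u n))).
  by rewrite ler_wpM2r ?seminorm_ge0// lerDl.
by rewrite mulrC -ler_pdivlMr// ltW// HN.
Qed.

HB.instance Definition _ :=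
  GRing.isSubmodClosed.Build R (nat -> E) cauchy_pred cauchy_submod_closed.

Record cauchy_seq := MkCauchySeq {
  cauchy_val :> nat -> E; _ : cauchy_val \in cauchy_pred }.

HB.instance Definition _ := [isSub for cauchy_val].
HB.instance Definition _ := [Choice of cauchy_seq by <:].
HB.instance Definition _ := [SubChoice_isSubLmodule of cauchy_seq by <:].

Lemma cauchy_seqP (u : cauchy_seq) (e : R) : 0 < e -> exists N,
  forall m n : nat, (N <= m)%N -> (N <= n)%N -> p (u m - u n) < e.
Proof. by case: u => u /= /asboolP; apply. Qed.

Definition null_pred : {pred cauchy_seq} :=
  [pred u : cauchy_seq | `[< p (u n) @[n --> \oo] --> (0 : R) >] ].

Lemma null_submod_closed : submod_closed null_pred.
Proof.
split=> [|a u v /asboolP cu /asboolP cv]; apply/asboolP.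
  rewrite (_ : (fun n => _) = cst 0); first exact: cvg_cst.
  by apply/funext => n; rewrite /= seminorm0.
have c : `|a| * p (u n) + p (v n) @[n --> \oo] --> (0 : R).
  rewrite -[X in _ --> X]addr0 -[X in X + _](mulr0 `|a|).
  by apply: cvgD => //; apply: cvgM => //; exact: cvg_cst.
apply: (squeeze_cvgr _ (cvg_cst 0) c); apply: nearW => n.
by rewrite seminorm_ge0/= -seminormZ; exact: seminormD.
Qed.

HB.instance Definition _ :=
  GRing.isSubmodClosed.Build R cauchy_seq null_pred null_submod_closed.

(* Cauchy sequences modulo null sequences. *)
Definition completion := Quotient.quot (null_pred : zmodClosed _).
HB.instance Definition _ := GRing.Zmodule.on completion.
HB.instance Definition _ := EqQuotient.on completion.


Local Notation "\cls u" := (\pi_(completion)%qT u) (at level 10).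

Lemma clsE (u v : cauchy_seq) :
  \cls u = \cls v <-> p (u n - v n) @[n --> \oo] --> (0 : R).
Proof.
split=> [/eqP|uv]; last apply/eqP.
  by rewrite -Quotient.idealrBE => /asboolP.
by rewrite -Quotient.idealrBE; apply/asboolP.
Qed.

Lemma clsD (u v : cauchy_seq) : \cls (u + v) = \cls u + \cls v.
Proof. by rewrite piE. Qed.

Lemma cls_repr (z : completion) : \cls (repr z) = z.
Proof. exact: reprK. Qed.

Definition completion_scale (a : R) (z : completion) : completion :=
  \cls (a *: repr z).

Lemma clsZ a (u : cauchy_seq) : \cls (a *: u) = completion_scale a (\cls u).
Proof.
apply/clsE; have /clsE uv : \cls u = \cls (repr (\cls u)) by rewrite cls_repr.
have -> : (fun n => p ((a *: u) n - (a *: repr (\cls u)) n)) =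
    cst `|a| \* (fun n => p (u n - repr (\cls u) n)).
  by apply/funext => n /=; rewrite -seminormZ scalerBr.
by rewrite -[X in _ --> X](mulr0 `|a|); apply: cvgM => //; exact: cvg_cst.
Qed.

Lemma completion_scaleA a b z :
  completion_scale a (completion_scale b z) = completion_scale (a * b) z.
Proof. by rewrite -(cls_repr z) -!clsZ scalerA. Qed.

Lemma completion_scale1 : left_id 1 completion_scale.
Proof. by move=> z; rewrite -(cls_repr z) -!clsZ scale1r. Qed.

Lemma completion_scaleDr : right_distributive completion_scale +%R.
Proof.
move=> a y z; rewrite -(cls_repr y) -(cls_repr z).
by rewrite -clsD -!clsZ scalerDr clsD.
Qed.

Lemma completion_scaleDl z : {morph completion_scale^~ z : a b / a + b}.
Proof. by move=> a b; rewrite -(cls_repr z) -!clsZ scalerDl clsD. Qed.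

HB.instance Definition _ := GRing.Zmodule_isLmodule.Build R completion
  completion_scaleA completion_scale1 completion_scaleDr completion_scaleDl.

Lemma cauchy_seq_norm_cvg (u : cauchy_seq) : cvgn (fun n => p (u n)).
Proof.
apply/cauchy_cvgP/cauchyP => e e0; have [N HN] := cauchy_seqP u e0.
exists (p (u N)); exists N => // n /= Nn; rewrite -ball_normE /ball_ /=.
exact: le_lt_trans (seminorm_dist _ _ _) (HN _ _ _ _).
Qed.

Definition completion_norm (z : completion) : R := limn (fun n => p (repr z n)).

Lemma completion_normE (u : cauchy_seq) :
  completion_norm (\cls u) = limn (fun n => p (u n)).
Proof.
apply: (cvg_lim (@Rhausdorff R)).
have /clsE uv : \cls (repr (\cls u)) = \cls u by rewrite cls_repr.
apply: (@cvg_sub0 _ _ _ _ _ _ (fun n => p (u n))); last exact: cauchy_seq_norm_cvg.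
apply/cvgr0Pnorm_lt => e e0; move/cvgr0Pnorm_lt : uv => /(_ e e0).
apply: filterS => n; apply: le_lt_trans.
by rewrite [leRHS]ger0_norm ?seminorm_ge0//; exact: seminorm_dist.
Qed.

Lemma completion_normD y z :
  completion_norm (y + z) <= completion_norm y + completion_norm z.
Proof.
rewrite -(cls_repr y) -(cls_repr z) -clsD !completion_normE.
rewrite -limD; [|exact: cauchy_seq_norm_cvg..].
apply: ler_lim; [exact: cauchy_seq_norm_cvg| |].
  by apply: is_cvgD; exact: cauchy_seq_norm_cvg.
by apply: nearW => n; exact: seminormD.
Qed.

Lemma completion_normZ (a : R) z :
  completion_norm (a *: z) = `|a| * completion_norm z.
Proof.
rewrite -(cls_repr z) -[a *: _]clsZ !completion_normE.
rewrite -[X in X * _](lim_cst (@Rhausdorff R) _ (F := \oo)).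
rewrite -limM; [|exact: is_cvg_cst|exact: cauchy_seq_norm_cvg].
by congr (limn _); apply/funext => n; rewrite /= -seminormZ.
Qed.

Lemma completion_norm_eq0 z : completion_norm z = 0 -> z = 0.
Proof.
rewrite -(cls_repr z) completion_normE => z0.
have -> : 0 = \cls 0 by rewrite piE.
apply/clsE; rewrite -z0.
rewrite (_ : (fun n => _) = (fun n => p (repr z n))).
  exact: cauchy_seq_norm_cvg.
by apply/funext => n /=; rewrite subr0.
Qed.

HB.instance Definition _ := Lmodule_isNormed.Build R completion
  completion_normD completion_normZ completion_norm_eq0.

Lemma cst_in_cauchy (x : E) : cst x \in cauchy_pred.
Proof.
by apply/asboolP => e e0; exists 0%N => m n _ _; rewrite subrr seminorm0.
Qed.

Definition to_completion (x : E) : completion := \cls (MkCauchySeq (cst_in_cauchy x)).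

Lemma to_completion_is_linear : linear to_completion.
Proof.
move=> a x y; rewrite -[a *: to_completion x]clsZ -clsD.
by congr (\cls _); apply: val_inj.
Qed.

HB.instance Definition _ := GRing.isLinear.Build R E completion _ to_completion
  to_completion_is_linear.

Lemma norm_to_completion x : `|to_completion x| = p x.
Proof.
rewrite -[LHS]/(completion_norm _) completion_normE.
apply: (cvg_lim (@Rhausdorff R)); exact: (@cvg_cst R (p x)).
Qed.

Lemma cauchy_seq_cvg (u : cauchy_seq) : to_completion (u n) @[n --> \oo] --> \cls u.
Proof.
apply/cvgrPdist_le => e e0; have [N HN] := cauchy_seqP u e0.
exists N => // n /= Nn; rewrite distrC.
have -> : to_completion (u n) - \cls u =
    \cls (MkCauchySeq (cst_in_cauchy (u n)) - u).
  by rewrite /to_completion piE.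
rewrite -[leLHS]/(completion_norm _) completion_normE.
apply: limr_le; first exact: cauchy_seq_norm_cvg.
by exists N => // m /= Nm; apply: ltW; exact: HN.
Qed.

Lemma to_completion_approx (z : completion) (e : R) : 0 < e ->
  exists x, `|z - to_completion x| < e.
Proof.
move=> e0; have := @cauchy_seq_cvg (repr z); rewrite cls_repr.
by move=> /cvgrPdist_lt/(_ e e0)[N _ /(_ N (leqnn N)) zN]; exists (repr z N).
Qed.

Lemma dense_to_completion : dense (range to_completion).
Proof.
move=> O [z Oz] oO; have := open_nbhs_nbhs (conj oO Oz).
move=> /nbhs_ballP[e /= e0 zO]; have [x zx] := to_completion_approx z e0.
exists (to_completion x); split; last by exists x.
by apply: zO; rewrite -ball_normE.
Qed.

Lemma completion_complete (F : set_system completion) :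
  ProperFilter F -> cauchy F -> cvg F.
Proof.
apply: complete_of_seq => z zc.
have /choice[x zx] (n : nat) : exists x, `|z n - to_completion x| < n.+1%:R^-1.
  by apply: to_completion_approx; rewrite invr_gt0.
have inve (e : R) : 0 < e -> exists N : nat, forall n, (N <= n)%N ->
    n.+1%:R^-1 < e.
  move=> e0; have [N _ HN] := near_infty_natSinv_lt (PosNum e0).
  by exists N => n /HN.
have xP : x \in cauchy_pred.
  apply/asboolP => e e0; have e3 : 0 < e / 3 by rewrite divr_gt0.
  have [N HN] := zc _ e3; have [M HM] := inve _ e3.
  exists (maxn N M) => m n; rewrite !geq_max => /andP[Nm Mm] /andP[Nn Mn].
  rewrite -norm_to_completion linearB/=.
  rewrite (_ : _ - _ = (z m - z n) - (z m - to_completion (x m)) +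
     (z n - to_completion (x n))); last first.
    by rewrite opprB [in RHS](addrC (z m - z n)) !subrKA.
  have -> : e = e / 3 + e / 3 + e / 3 by lra.
  apply: le_lt_trans (ler_normD _ _) _; rewrite ltrD//; last first.
    exact: lt_trans (zx n) (HM n Mn).
  apply: le_lt_trans (ler_normB _ _) _; rewrite ltrD//; first exact: HN.
  exact: lt_trans (zx m) (HM m Mm).
apply/cvg_ex; exists (\cls (MkCauchySeq xP)).
apply: cvg_sub0 (@cauchy_seq_cvg (MkCauchySeq xP)).
apply/cvgr0Pnorm_lt => e e0; have [N HN] := inve e e0.
by exists N => // n /= Nn; apply: lt_trans (zx n) (HN n Nn).
Qed.

HB.instance Definition _ :=
  Uniform_isComplete.Build completion completion_complete.

End completion.

Definition inj_tensor (R : realType) (n : nat) (X : normedModType R) :=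
  completion (inj_seminorm n X).

HB.instance Definition _ (R : realType) n (X : normedModType R) :=
  CompleteNormedModule.on (inj_tensor n X).

(* [T] is a linear homeomorphism of [Y] onto the linear subspace [range T]. *)
Definition isomorphic_to_subspace (R : realType) (Y Z : normedModType R) :=
  exists T : {linear Y -> Z}, continuous T /\
    exists2 S : Z -> Y, cancel T S & {within range T, continuous S}.

(* Main.v *)
Require Import Defs.
From HB Require Import structures.
From mathcomp Require Import all_boot all_order all_algebra.
From mathcomp Require Import all_classical all_reals all_analysis.
From mathcomp Require Import ring lra zify.

(** Write X for l1, e_n for its unit vectors, and E for the 2-fold injective
    tensor product of X. The two spaces are told apart by the size of
    ||sum_(j<k) y_j||, where y_j is a difference of two terms of a given
    separated bounded sequence z_j and one is free to choose the two terms.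

    In E the norm of such a sum can be forced to be at least of order sqrt k
    ([sqrt_lower_estimate]). An element of E is, up to a small error, a finite
    matrix A with the norm sup |sum A_pq s_p t_q| over |s|, |t| <= 1. By the
    pigeonhole principle applied to the entries in a fixed box [0,N)^2, some
    difference z_j n - z_j m is almost zero on that box ([exists_block]).
    Choosing N beyond the supports of the matrices already selected makes the
    y_j almost disjoint: the j-th matrix lives on the rows and the columns of
    the j-th interval J_j = [N_j, N_(j+1)), up to indices below N_(j+1). The sum
    S of the matrices then almost equals y_j on the new columns, that is on the
    columns of J_j and the rows below N_(j+1), and likewise on the new rows, so
    S is not small on many disjoint sets of columns or of rows. If S has
    norm M, then sum_j ||S t_j||_1 <= 2 sqrt k M for test vectors t_j with
    disjoint supports ([sum_columns_le]); this is Khintchine's inequality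
    ([khintchine]) in the rows, since random signs in front of the t_j give
    again a vector bounded by 1. Hence sqrt k is a lower bound
    ([sum_blocks_lower]).

    In the 3-fold product no such bound is possible. Let r_j be the
    normalized Rademacher vector in X, indexed by the 2^k choices of signs, and
    let x_j n = r_j (x) r_j (x) e_n. Two terms of the sequence x_j are at
    distance at least 1, but Bessel's inequality applied to f_1(r_j) and
    f_2(r_j) bounds by 2 every sum over j of differences x_j n_j - x_j m_j,
    whatever the n_j and m_j are ([sum_test_tensor_le]): the r_j (x) r_j span
    l_infty^k isometrically. An isomorphism into E would carry this bounded
    sum to one of norm at least of order sqrt k. *)

Set Implicit Arguments.
Unset Strict Implicit.
Unset Printing Implicit Defensive.
Import Order.TTheory GRing.Theory Num.Theory.
Import numFieldNormedType.Exports.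
Local Open Scope ring_scope.

(** * Rademacher functions *)

Section rademacher.
Variables (R : realType) (k : nat).
Local Notation signs := {ffun 'I_k -> bool}.

Definition rademacher (i : 'I_k) (w : signs) : R := (-1) ^+ w i.

Definition flip (i : 'I_k) (w : signs) : signs :=
  [ffun j => (j == i) (+) w j].

Lemma flipK i : involutive (flip i).
Proof. by move=> w; apply/ffunP => j; rewrite !ffunE addbA addbb. Qed.

Lemma rademacher_flip i j w :
  rademacher j (flip i w) = (-1) ^+ (j == i) * rademacher j w.
Proof. by rewrite /rademacher ffunE signr_addb. Qed.

Lemma rademacher_sqr i w : rademacher i w ^+ 2 = 1.
Proof. by rewrite /rademacher sqrr_sign. Qed.

Lemma normr_rademacher i w : `|rademacher i w| = 1.
Proof. by rewrite /rademacher normr_sign. Qed.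

(** Flipping the i-th sign reverses the sign of every term. *)
Lemma sum_rademacher_indep i (G : signs -> R) :
  (forall w, G (flip i w) = G w) -> \sum_w rademacher i w * G w = 0.
Proof.
move=> Gi; set S := LHS.
suff : S = - S by lra.
rewrite {1}/S (reindex_inj (inv_inj (@flipK i))) -sumrN.
by apply: eq_bigr => w _; rewrite rademacher_flip eqxx Gi mulN1r mulNr.
Qed.

Definition rademacher_sum (r : seq 'I_k) (a : 'I_k -> R) (w : signs) : R :=
  \sum_(i <- r) a i * rademacher i w.

Lemma rademacher_sum_flip i r a w : i \notin r ->
  rademacher_sum r a (flip i w) = rademacher_sum r a w.
Proof.
move=> ir; rewrite /rademacher_sum !big_seq; apply: eq_bigr => j jr.
by rewrite rademacher_flip (negbTE (memPn ir j jr)) mul1r.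
Qed.

Lemma sum_rademacher_sum_sqr r a : uniq r ->
  \sum_w rademacher_sum r a w ^+ 2 = #|{: signs}|%:R * \sum_(i <- r) a i ^+ 2.
Proof.
elim: r => [_|i r IH /= /andP[ir ur]].
  by rewrite big_nil mulr0 big1// => w _; rewrite /rademacher_sum big_nil expr0n.
rewrite big_cons mulrDr -IH//.
have -> : \sum_w rademacher_sum (i :: r) a w ^+ 2 = \sum_w (a i ^+ 2 +
    (2 * a i) * (rademacher i w * rademacher_sum r a w) + rademacher_sum r a w ^+ 2).
  apply: eq_bigr => w _; rewrite {1}/rademacher_sum big_cons -/(rademacher_sum r a w).
  have := rademacher_sqr i w; move: (rademacher i w) => e e2.
  by rewrite sqrrD exprMn e2; ring.
rewrite !big_split/= -[\sum_w 2 * _ * _]mulr_sumr sum_rademacher_indep.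
  by rewrite sumr_const -mulr_natl; ring.
by move=> w; rewrite rademacher_sum_flip.
Qed.

(** Adding a term a e to a sum x with fewer signs, the odd powers of e average
    to zero in (x + a e)^4, and a^4 + 6 a^2 x^2 + x^4 averages to at most
    3 (a^2 + |x|^2)^2, where |x|^2 is the second moment of x. *)
Lemma sum_rademacher_sum_pow4 r a : uniq r ->
  \sum_w rademacher_sum r a w ^+ 4 <=
    3 * #|{: signs}|%:R * (\sum_(i <- r) a i ^+ 2) ^+ 2.
Proof.
elim: r => [_|i r IH /= /andP[ir ur]].
  rewrite big_nil expr0n mulr0 big1// => w _.
  by rewrite /rademacher_sum big_nil expr0n.
have -> : \sum_w rademacher_sum (i :: r) a w ^+ 4 = \sum_w (a i ^+ 4 +
    (4 * a i ^+ 3) * (rademacher i w * rademacher_sum r a w) +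
    (4 * a i) * (rademacher i w * rademacher_sum r a w ^+ 3) +
    (6 * a i ^+ 2) * rademacher_sum r a w ^+ 2 + rademacher_sum r a w ^+ 4).
  apply: eq_bigr => w _; rewrite {1}/rademacher_sum big_cons -/(rademacher_sum r a w).
  have := rademacher_sqr i w; move: (rademacher i w) (rademacher_sum r a w) => e x e2.
  rewrite (_ : (a i * e + x) ^+ 4 = a i ^+ 4 * (e ^+ 2) ^+ 2
    + 4 * a i ^+ 3 * (e ^+ 2 * e * x) + 6 * a i ^+ 2 * e ^+ 2 * x ^+ 2 +
    4 * a i * (e * x ^+ 3) + x ^+ 4); last by ring.
  by rewrite e2 expr1n; ring.
rewrite !big_split/= -[\sum_w 4 * _ * (_ * rademacher_sum _ _ _)]mulr_sumr.
rewrite -[\sum_w 4 * _ * _]mulr_sumr -[\sum_w 6 * _ * _]mulr_sumr.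
rewrite !sum_rademacher_indep; last 2 first.
- by move=> w; rewrite rademacher_sum_flip.
- by move=> w; rewrite rademacher_sum_flip.
rewrite sum_rademacher_sum_sqr// sumr_const -mulr_natl big_cons.
have := IH ur; set L := #|_|%:R; set s := \sum_(j <- r) a j ^+ 2.
have L0 : 0 <= L by rewrite ler0n.
have := mulr_ge0 L0 (exprn_even_ge0 (a i) (isT : ~~ odd 4)); set x := a i => h1 h2.
apply: (le_trans (lerD (lexx _) h2)); rewrite -subr_ge0.
by rewrite (_ : _ - _ = 2 * (L * x ^+ 4)); [rewrite mulr_ge0|ring].
Qed.

(** The L1 norm of a Rademacher sum dominates its L2 norm, because its fourth
    moment is bounded by three times the square of the second one; the
    Cauchy-Schwarz inequality then replaces the l2 norm of the coefficients
    by their l1 norm, which is the form that can be summed over the rows of a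
    matrix. *)
Lemma khintchine (a : 'I_k -> R) :
  #|{: signs}|%:R * \sum_i `|a i| <=
  2 * Num.sqrt k%:R * \sum_w `|\sum_i a i * rademacher i w|.
Proof.
set L := #|_|%:R; set s2 := \sum_i a i ^+ 2; set s := Num.sqrt s2.
have L0 : 0 <= L by rewrite ler0n.
have s20 : 0 <= s2 by apply: sumr_ge0 => i _; exact: sqr_ge0.
have sE : s ^+ 2 = s2 by rewrite sqr_sqrtr.
have CS : \sum_i `|a i| <= Num.sqrt k%:R * s.
  rewrite -sqrtrM ?ler0n// -[leLHS]ger0_norm; last exact: sumr_ge0.
  rewrite -sqrtr_sqr ler_sqrt ?sqr_ge0// ?mulr_ge0//.
  set t := \sum_i `|a i|.
  have [k0|k0] := posnP k.
    rewrite (_ : t = 0) ?expr0n ?mulr_ge0// /t big1// => i _.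
    by have := ltn_ord i; rewrite {2}k0.
  have kp : 0 < k%:R :> R by rewrite ltr0n.
  have : 0 <= \sum_(i < k) (k%:R * `|a i| - t) ^+ 2.
    by apply: sumr_ge0 => i _; exact: sqr_ge0.
  have -> : \sum_(i < k) (k%:R * `|a i| - t) ^+ 2 =
     k%:R * (k%:R * s2 - t ^+ 2).
    have sqE i : (k%:R * `|a i| - t) ^+ 2 =
        k%:R ^+ 2 * a i ^+ 2 - 2 * k%:R * t * `|a i| + t ^+ 2.
      by rewrite -(real_normK (num_real (a i))); ring.
    rewrite (eq_bigr _ (fun i _ => sqE i)) !big_split/= sumrN -!mulr_sumr.
    by rewrite sumr_const card_ord -mulr_natl -/t -/s2; ring.
  by rewrite pmulr_rge0// subr_ge0.
have [s0|sn0] := eqVneq s 0.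
  rewrite s0 mulr0 in CS; apply: (@le_trans _ _ 0).
    by rewrite mulr_ge0_le0.
  by rewrite !mulr_ge0 ?sqrtr_ge0// sumr_ge0.
have sp : 0 < s by rewrite lt_def sn0 sqrtr_ge0.
(* The quartic minorant of the absolute value that touches it at 2 s; its
   average involves the second and fourth moments only. *)
have low (x : R) : 3 / 4 / s * x ^+ 2 - x ^+ 4 / (16 * s ^+ 3) <= `|x|.
  have -> : x ^+ 4 = (`|x| ^+ 2) ^+ 2.
    by rewrite real_normK ?num_real// -exprM.
  rewrite -(real_normK (num_real x)).
  have : 0 <= `|x| by [].
  move: `|x| => t t0; rewrite -subr_ge0.
  have -> : t - (3 / 4 / s * t ^+ 2 - (t ^+ 2) ^+ 2 / (16 * s ^+ 3)) =
    t * ((t - 2 * s) ^+ 2 * (t + 4 * s)) / (16 * s ^+ 3) by field.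
  have s0 := ltW sp; apply: divr_ge0; last by rewrite mulr_ge0 ?exprn_ge0.
  by apply: mulr_ge0 => //; apply: mulr_ge0; [exact: sqr_ge0|lra].
have E (w : signs) :
  \sum_i a i * rademacher i w = rademacher_sum (index_enum 'I_k) a w by [].
under [X in _ <= _ * X]eq_bigr => w _ do rewrite E.
set X := rademacher_sum _ _.
have m2 : \sum_w X w ^+ 2 = L * s2 by exact/sum_rademacher_sum_sqr/index_enum_uniq.
have m4 : \sum_w X w ^+ 4 <= 3 * L * s2 ^+ 2.
  exact/sum_rademacher_sum_pow4/index_enum_uniq.
have main : L * s <= 2 * \sum_w `|X w|.
  have : 3 / 4 / s * \sum_w X w ^+ 2 - (\sum_w X w ^+ 4) / (16 * s ^+ 3) <=
      \sum_w `|X w|.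
    rewrite mulr_sumr mulr_suml -sumrB; apply: ler_sum => w _; exact: low.
  rewrite m2 -sE.
  have : (\sum_w X w ^+ 4) / (16 * s ^+ 3) <= 3 / 16 * (L * s).
    rewrite ler_pdivrMr ?mulr_gt0 ?exprn_gt0//.
    by rewrite (le_trans m4)// -sE le_eqVlt; apply/orP; left; apply/eqP; field.
  have -> : 3 / 4 / s * (L * s ^+ 2) = 3 / 4 * (L * s) by field.
  have := mulr_ge0 L0 (ltW sp).
  lra.
rewrite (mulrC 2) -mulrA.
apply: le_trans (ler_wpM2l (sqrtr_ge0 _) main).
by rewrite mulrCA ler_wpM2l.
Qed.

(** The Rademacher functions are orthonormal for the uniform probability, and F
    has norm at most 1 there. *)
Lemma bessel (F : signs -> R) : (forall w, `|F w| <= 1) ->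
  \sum_i (#|{: signs}|%:R^-1 * \sum_w rademacher i w * F w) ^+ 2 <= 1.
Proof.
move=> F1; set L := #|_|%:R; pose c i := L^-1 * \sum_w rademacher i w * F w.
rewrite -/c.
have L0 : 0 < L by rewrite ltr0n; apply/card_gt0P; exists [ffun=> true].
have cE i : \sum_w rademacher i w * F w = L * c i.
  by rewrite /c mulrA divff ?gt_eqF ?mul1r.
have : 0 <= \sum_w (F w - rademacher_sum (index_enum 'I_k) c w) ^+ 2.
  by apply: sumr_ge0 => w _; exact: sqr_ge0.
under eq_bigr do rewrite sqrrB.
rewrite !big_split/= sumrN sum_rademacher_sum_sqr ?index_enum_uniq// -/L.
have -> : \sum_w F w * rademacher_sum (index_enum 'I_k) c w *+ 2 =
    2 * (L * \sum_i c i ^+ 2).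
  under eq_bigr => w _ do rewrite -mulr_natl /rademacher_sum mulr_sumr.
  rewrite -mulr_sumr; congr (2 * _); rewrite exchange_big/= mulr_sumr.
  apply: eq_bigr => i _; rewrite [in RHS]expr2 mulrCA -cE mulr_sumr.
  by apply: eq_bigr => w _; ring.
have : \sum_w F w ^+ 2 <= L.
  rewrite /L -[X in _ <= X]mulr_natr mul1r -sumr_const.
  apply: ler_sum => w _; rewrite -real_normK ?num_real//.
  by rewrite expr_le1.
move=> h1 h2; rewrite -(ler_pM2l L0) mulr1; lra.
Qed.

End rademacher.

(** * Almost disjoint matrices *)

Section matrices.
Variable R : realType.
Implicit Types (A : nat -> nat -> R) (s t : nat -> R).

Definition bilin N A s t : R := \sum_(p < N) \sum_(q < N) A p q * s p * t q.

Definition bilin_bounded N A M := forall s t,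
  (forall p, `|s p| <= 1) -> (forall q, `|t q| <= 1) -> `|bilin N A s t| <= M.

Lemma bilinT N A s t : bilin N (fun p q => A q p) s t = bilin N A t s.
Proof.
rewrite /bilin exchange_big/=; apply: eq_bigr => p _; apply: eq_bigr => q _.
by rewrite mulrAC.
Qed.

Lemma bilin_boundedT N A M :
  bilin_bounded N A M -> bilin_bounded N (fun p q => A q p) M.
Proof. by move=> AM s t s1 t1; rewrite bilinT; exact: AM. Qed.

(** For all signs e_j the vector sum_j e_j t_j is still bounded by 1, so the l1
    norm of its image under A is at most M. Averaging over the signs and
    applying Khintchine's inequality in each row gives the bound. *)
Lemma sum_columns_le k N A M (t : 'I_k -> nat -> R) : bilin_bounded N A M ->
  (forall q, \sum_j `|t j q| <= 1) ->
  \sum_j \sum_(p < N) `|\sum_(q < N) A p q * t j q| <= 2 * Num.sqrt k%:R * M.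
Proof.
move=> AM t1; set L : R := #|{: {ffun 'I_k -> bool}}|%:R.
have L0 : 0 < L by rewrite ltr0n; apply/card_gt0P; exists [ffun=> true].
rewrite -(ler_pM2l L0) exchange_big/= mulr_sumr.
pose z (j : 'I_k) (p : 'I_N) := \sum_(q < N) A p q * t j q.
apply: (@le_trans _ _ (\sum_(p < N) 2 * Num.sqrt k%:R *
    \sum_w `|\sum_j z j p * rademacher R j w|)).
  by apply: ler_sum => p _; exact: (khintchine (z^~ p)).
rewrite -mulr_sumr exchange_big/= mulrCA ler_wpM2l ?mulr_ge0//.
rewrite /L mulr_natl -sumr_const; apply: ler_sum => w _.
(* s selects the signs for which the form computes the l1 norm of the image. *)
pose s p := Num.sg (\sum_j (\sum_(q < N) A p q * t j q) * rademacher R j w).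
have <- : bilin N A s (fun q => \sum_j t j q * rademacher R j w) =
    \sum_(p < N) `|\sum_j z j p * rademacher R j w|.
  apply: eq_bigr => p _; rewrite normrEsg -/(s p).
  rewrite [in RHS]mulr_sumr; under [RHS]eq_bigr => j _ do
    rewrite mulrCA /z mulr_suml.
  rewrite [RHS]exchange_big; apply: eq_bigr => q _ /=.
  by rewrite mulr_sumr; apply: eq_bigr => j _; ring.
apply: le_trans (ler_norm _) (AM _ _ _ _) => [p|q].
  by rewrite /s normr_sg; case: eqP.
apply: le_trans (t1 q); apply: le_trans (ler_norm_sum _ _ _) _.
by apply: ler_sum => j _; rewrite normrM normr_rademacher mulr1.
Qed.

Section blocks.
Variables (k : nat) (N_ : nat -> nat) (B : nat -> nat -> nat -> R) (eta M : R).
Hypothesis N_homo : {homo N_ : i j / (i <= j)%N}.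
Hypothesis B_supp : forall j p q, ~~ ((p < N_ j.+1) && (q < N_ j.+1))%N ->
  B j p q = 0.
Hypothesis B_box : forall j, (j < k)%N ->
  \sum_(p < N_ j) \sum_(q < N_ j) `|B j p q| <= eta.
Hypothesis eta0 : 0 <= eta.
Local Notation N := (N_ k).

(** Extended by zero, so that the boxes of different sizes can be summed over a
    common range of indices. *)
Definition box j p q : R :=
  if ((p < N_ j) && (q < N_ j))%N then `|B j p q| else 0.

Lemma sum_box j : (j < k)%N -> \sum_(p < N) \sum_(q < N) box j p q <= eta.
Proof.
move=> jk; apply: le_trans (B_box jk).
have NN : (N_ j <= N)%N by apply: N_homo; exact: ltnW.
rewrite (big_ord_widen_cond N predT
  (fun p => \sum_(q < N_ j) `|B j p q|) NN) [leRHS]big_mkcond/=.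
apply: ler_sum => p _; rewrite /box; case: ifPn => pN; last by rewrite big1.
rewrite (big_ord_widen_cond N predT (fun q => `|B j p q|) NN).
by rewrite [leRHS]big_mkcond.
Qed.

Definition cut j (t : nat -> R) q : R := if (N_ j <= q < N_ j.+1)%N then t q else 0.

Lemma sum_norm_cut_le (t : nat -> nat -> R) q : (forall j p, `|t j p| <= 1) ->
  \sum_(j < k) `|cut j (t j) q| <= 1.
Proof.
move=> t1; have [[j Jj]|nJ] := pselect (exists j : 'I_k, N_ j <= q < N_ j.+1)%N.
  rewrite (bigD1 j)//= big1 ?addr0 => [|i ij].
    by rewrite /cut; case: ifP => // _; rewrite normr0.
  rewrite /cut; case: ifPn => [Ji|_]; last by rewrite normr0.
  have : (i : nat) != j by [].
  case: ltngtP => // lij _.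
    have := N_homo lij; lia.
  have := N_homo lij; lia.
rewrite big1// => j _; rewrite /cut; case: ifPn => [Jj|_]; last by rewrite normr0.
by case: nJ; exists j.
Qed.

Local Notation S := (fun p q => \sum_(i < k) B i p q).

(** On the new columns of B j, the earlier matrices vanish and each later one
    is in its own box, where it is small. *)
Lemma dist_sum_block j p q : (j < k)%N -> (p < N_ j.+1)%N ->
  (N_ j <= q < N_ j.+1)%N -> `|S p q - B j p q| <= \sum_(i < k) box i p q.
Proof.
move=> jk pj qj; rewrite /= (bigD1 (Ordinal jk))//= addrC addrK.
apply: le_trans (ler_norm_sum _ _ _) _.
rewrite [leRHS](bigD1 (Ordinal jk))//=.
have b0 i : 0 <= box i p q by rewrite /box; case: ifP.
rewrite (@le_trans _ _ (\sum_(i < k | i != Ordinal jk) box i p q))// ?lerDr//.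
apply: ler_sum => i ij; have {ij} : (i : nat) != j by [].
rewrite /box; case: ifPn => // out; case: ltngtP => // lij _.
  rewrite B_supp ?normr0//; have := N_homo lij; lia.
have := N_homo lij; lia.
Qed.

(** [sum_columns_le] for S, where the new columns of S are replaced by those of
    B j; for each j the error is at most the sum of all the boxes. *)
Lemma sum_new_columns_le (t : nat -> nat -> R) : bilin_bounded N S M ->
  (forall j p, `|t j p| <= 1) ->
  \sum_(j < k) \sum_(p < N) `|\sum_(q < N) B j p q * cut j (t j) q| <=
  2 * Num.sqrt k%:R * M + k%:R * (k%:R * eta).
Proof.
move=> SM t1.
apply: le_trans (lerD (sum_columns_le SM (fun q => sum_norm_cut_le q t1)) (lexx _)).
have -> : k%:R * (k%:R * eta) = \sum_(j < k) k%:R * eta.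
  by rewrite sumr_const card_ord mulr_natl.
rewrite -big_split/=; apply: ler_sum => j _.
apply: (@le_trans _ _ (\sum_(p < N) (`|\sum_(q < N) S p q * cut j (t j) q| +
    \sum_(q < N) \sum_(i < k) box i p q))); last first.
  rewrite big_split/= lerD2l.
  under eq_bigr do rewrite exchange_big.
  rewrite exchange_big/= mulr_natl.
  rewrite (le_trans (ler_sum _ (fun i _ => sum_box (ltn_ord i))))//.
  by rewrite sumr_const card_ord.
have b0 i p q : 0 <= box i p q by rewrite /box; case: ifP.
apply: ler_sum => p _.
have [pj|pj] := ltnP p (N_ j.+1); last first.
  have -> : \sum_(q < N) B j p q * cut j (t j) q = 0.
    by rewrite big1// => q _; rewrite B_supp ?mul0r//; lia.
  rewrite normr0 addr_ge0// sumr_ge0// => q _; exact: sumr_ge0.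
rewrite -lerBlDl; apply: le_trans (lerB_dist _ _) _.
rewrite -sumrB; apply: le_trans (ler_norm_sum _ _ _) _.
apply: ler_sum => q _; rewrite -mulrBl normrM /cut distrC.
case: ifPn => qj; last by rewrite normr0 mulr0 sumr_ge0.
apply: le_trans (dist_sum_block (ltn_ord j) pj qj).
by rewrite ler_piMr.
Qed.

End blocks.

(** Each matrix is carried, up to its box, by its new columns and its new rows,
    and both contributions are controlled by the sum of the matrices; the rows
    are the columns of the transposed matrices. *)
Lemma sum_blocks_lower k (N_ : nat -> nat) (B : nat -> nat -> nat -> R)
    (eta M delta : R) :
  {homo N_ : i j / (i <= j)%N} ->
  (forall j p q, ~~ ((p < N_ j.+1) && (q < N_ j.+1))%N -> B j p q = 0) ->
  (forall j, (j < k)%N -> \sum_(p < N_ j) \sum_(q < N_ j) `|B j p q| <= eta) ->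
  0 <= eta ->
  bilin_bounded (N_ k) (fun p q => \sum_(j < k) B j p q) M ->
  (forall j, (j < k)%N -> exists s t, [/\ forall p, `|s p| <= 1,
     forall q, `|t q| <= 1 & delta <= `|bilin (N_ k) (B j) s t|]) ->
  k%:R * delta <= 4 * Num.sqrt k%:R * M + k%:R * (1 + 2 * k%:R) * eta.
Proof.
move=> Nh Bs Bb eta0 SM low; set N := N_ k.
have /choice[s /choice[t st]] (j : nat) : exists s, exists t,
    [/\ forall p, `|s p| <= 1, forall q, `|t q| <= 1
      & (j < k)%N -> delta <= `|bilin N (B j) s t|].
  have [jk|jk] := ltnP j k; first by have [s [t [? ? ?]]] := low j jk; exists s, t.
  by exists (fun=> 0), (fun=> 0); split=> // ?; rewrite normr0.
have s1 j p : `|s j p| <= 1 by case: (st j).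
have t1 j q : `|t j q| <= 1 by case: (st j).
have cols := sum_new_columns_le Nh Bs Bb eta0 SM t1.
have BsT j p q : ~~ ((p < N_ j.+1) && (q < N_ j.+1))%N -> B j q p = 0.
  by rewrite andbC; exact: Bs.
have BbT j : (j < k)%N -> \sum_(p < N_ j) \sum_(q < N_ j) `|B j q p| <= eta.
  by move=> jk; rewrite exchange_big/=; exact: Bb.
have rows := sum_new_columns_le Nh BsT BbT eta0 (bilin_boundedT SM) s1.
have key (j : 'I_k) : delta <=
    \sum_(p < N) `|\sum_(q < N) B j p q * cut N_ j (t j) q| +
    \sum_(q < N) `|\sum_(p < N) B j p q * cut N_ j (s j) p| + eta.
  have [_ _ /(_ (ltn_ord j))] := st j; move=> /le_trans; apply.
  have b1 := sum_box Nh Bb (ltn_ord j).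
  (* A pair (p, q) in the support has q new, or p new and q old, or both old. *)
  pose r p q := if ((p < N_ j) && (q < N_ j))%N then B j p q * s j p * t j q else 0.
  have -> : bilin N (B j) (s j) (t j) =
     \sum_(p < N) s j p * (\sum_(q < N) B j p q * cut N_ j (t j) q) +
     \sum_(q < N) (if (q < N_ j)%N then t j q else 0) *
        (\sum_(p < N) B j p q * cut N_ j (s j) p) +
     \sum_(p < N) \sum_(q < N) r p q.
    under [X in _ + X + _]eq_bigr do rewrite mulr_sumr.
    rewrite [X in _ + X + _]exchange_big/= -!big_split/=; apply: eq_bigr => p _.
    rewrite mulr_sumr -!big_split/=; apply: eq_bigr => q _; rewrite /cut /r.
    have [pj|pj] := ltnP p (N_ j.+1); last
      by rewrite Bs; [do ?case: ifP => _; ring|lia].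
    have [qj|qj] := ltnP q (N_ j.+1); last
      by rewrite Bs; [do ?case: ifP => _; ring|lia].
    by case: (leqP (N_ j)) => _; case: (leqP (N_ j)) => _ /=; ring.
  apply: le_trans (ler_normD _ _) (lerD _ _).
    apply: le_trans (ler_normD _ _) (lerD _ _);
      apply: le_trans (ler_norm_sum _ _ _) _; apply: ler_sum => p _;
      rewrite normrM ler_piMl//.
    by case: ifP => _; rewrite ?normr0.
  apply: le_trans b1; apply: le_trans (ler_norm_sum _ _ _) _.
  apply: ler_sum => p _; apply: le_trans (ler_norm_sum _ _ _) _.
  apply: ler_sum => q _; rewrite /r /box; case: ifP => _; last by rewrite normr0.
  by rewrite !normrM -mulrA ler_piMr// mulr_ile1.
have : \sum_(j < k) delta <= \sum_(j < k) (
    \sum_(p < N) `|\sum_(q < N) B j p q * cut N_ j (t j) q| +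
    \sum_(q < N) `|\sum_(p < N) B j p q * cut N_ j (s j) p| + eta).
  by apply: ler_sum => j _; exact: key.
rewrite !big_split/= !sumr_const card_ord.
rewrite -[delta *+ k]mulr_natl -[eta *+ k]mulr_natl => h.
apply: (le_trans h); apply: (le_trans (lerD (lerD cols rows) (lexx _))).
by rewrite le_eqVlt; apply/orP; left; apply/eqP; ring.
Qed.

End matrices.

(** * Functionals and truncations on l1 *)

Section l1_facts.
Variable R : realType.
Local Notation X := (l1 R).

Definition delta (n p : nat) : R := (p == n)%:R.

Lemma sum_norm_delta n m : \sum_(0 <= p < m) `|delta n p| = (n < m)%N%:R.
Proof.
elim: m => [|m IH]; first by rewrite big_nil.
rewrite big_nat_recr//= IH /delta ltnS.
by case: ltngtP => _; rewrite ?normr0 ?normr1 ?addr0 ?add0r.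
Qed.

Lemma delta_in_l1 n : delta n \in @l1_pred R.
Proof.
apply/asboolP; apply: nondecreasing_is_cvgn.
  exact: nondecreasing_normed_series.
by exists 1 => _ [m _ <-]; rewrite normed_seriesE sum_norm_delta lern1; case: ltnP.
Qed.

Definition unit_vec n : X := MkL1 (delta_in_l1 n).

Lemma norm_unit_vec n : `|unit_vec n| <= 1.
Proof.
apply: limr_le; first exact: l1_cvg.
by apply: nearW => m; rewrite normed_seriesE/= sum_norm_delta lern1; case: ltnP.
Qed.

(** Finite sums avoid any question of convergence, and these functionals are
    enough to compute the injective norm of a finite matrix. *)
Definition pairing (N : nat) (s : nat -> R) (x : X) : R^o := \sum_(p < N) s p * x p.

Lemma pairing_is_linear N s : linear (pairing N s).
Proof.
move=> a x y; rewrite /pairing scaler_sumr -big_split; apply: eq_bigr => p _.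
exact: etrans (mulrDr _ _ _) (congr1 (+%R^~ _) (mulrCA _ _ _)).
Qed.

HB.instance Definition _ N s := GRing.isLinear.Build R X R^o _ (pairing N s)
  (pairing_is_linear N s).

Lemma dual_ball_pairing N s : (forall p, `|s p| <= 1) -> dual_ball (pairing N s).
Proof.
move=> s1.
have le1 x : `|pairing N s x| <= `|x|.
  rewrite /pairing; apply: le_trans (ler_norm_sum _ _ _) _.
  apply: le_trans (l1_norm_ge x N); rewrite normed_seriesE big_mkord.
  by apply: ler_sum => p _; rewrite normrM ler_piMl.
split.
  apply: bounded_linear_continuous; apply/linear_boundedP.
  exists 1; split => // r /ltW r1 x.
  by apply: le_trans (le1 x) _; rewrite ler_peMl.
apply: ge_ereal_sup => _ [x /= x1 <-]; rewrite lee_fin.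
exact: le_trans (le1 x) x1.
Qed.

Lemma pairing_unit_vec N s n : (n < N)%N -> pairing N s (unit_vec n) = s n.
Proof.
move=> nN; rewrite /pairing (bigD1 (Ordinal nN))//= /delta eqxx mulr1.
rewrite big1 ?addr0// => i ni; rewrite (_ : (i : nat) == n = false) ?mulr0//.
exact: negbTE.
Qed.

Lemma dual_ball_unit_vec (f : {linear X -> R^o}) n :
  dual_ball f -> `|f (unit_vec n)| <= 1.
Proof.
by move=> f1; apply: le_trans (dual_ball_le _ f1) (norm_unit_vec n).
Qed.

(* The n-th coordinate functional; a notation, so that the linear structure of
   [pairing] is found. *)
Local Notation coord n := (pairing n.+1 (delta n)).

Lemma normr_delta n p : `|delta n p| <= 1.
Proof. by rewrite /delta; case: eqP => _; rewrite ?normr0 ?normr1. Qed.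

Lemma coordE n (x : X) : coord n x = x n.
Proof.
rewrite /pairing big_ord_recr/= /delta eqxx mul1r big1 ?add0r// => i _.
by rewrite ltn_eqF ?mul0r.
Qed.

Lemma coord_unit_vec n m : coord n (unit_vec m) = (n == m)%:R.
Proof. by rewrite coordE. Qed.

Definition trunc N (x : X) : X := \sum_(p < N) x p *: unit_vec p.

Lemma truncE N x n : trunc N x n = if (n < N)%N then x n else 0.
Proof.
rewrite -coordE /trunc linear_sum/=.
under eq_bigr => p _ do rewrite linearZ/= coord_unit_vec.
case: ltnP => nN; last first.
  rewrite big1// => p _; rewrite gtn_eqF ?scaler0//.
  exact: leq_trans nN.
rewrite (bigD1 (Ordinal nN))//= eqxx big1 ?addr0 => [|i ni].
  exact: mulr1.
rewrite (_ : n == i :> nat = false) ?scaler0//.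
by rewrite eq_sym; exact: negbTE.
Qed.

Lemma l1B (x y : X) n : (x - y) n = x n - y n.
Proof. by []. Qed.

(** The norm of x - trunc N x is the tail of the series that defines |x|. *)
Lemma trunc_cvg (x : X) (e : R) : 0 < e ->
  exists N0, forall N, (N0 <= N)%N -> `|x - trunc N x| <= e.
Proof.
move=> e0; have /cvgrPdist_le/(_ e e0)[N0 _ HN] := @l1_cvg R x.
exists N0 => N N0N; apply: limr_le; first exact: l1_cvg.
exists N => // n Nn.
have : `|l1_norm x - \sum_(0 <= k < N) `|x k| | <= e := HN N N0N.
have : \sum_(0 <= k < n) `|x k| <= l1_norm x := l1_norm_ge x n.
move: (l1_norm x) => l.
suff -> : [normed series (x - trunc N x : X)] n = \sum_(N <= k < n) `|x k|.
  rewrite (big_cat_nat (leq0n N) Nn)/=.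
  set a := \sum_(0 <= k < N) _; set b := \sum_(N <= k < n) _ => h2 h1.
  by move: h1 => /ler_normlP[_]; lra.
have dE k : l1_val (x - trunc N x) k = if (k < N)%N then 0 else x k.
  by rewrite l1B truncE; case: ifP; rewrite ?subrr ?subr0.
rewrite normed_seriesE (big_cat_nat (leq0n N) Nn)/= big_nat_cond big1 ?add0r.
  apply: eq_big_nat => k /andP[Nk _]; congr `|_|; apply: etrans (dE k) _.
  by rewrite ltnNge Nk.
move=> k /andP[/andP[_ kN] _]; apply/eqP; rewrite normr_eq0; apply/eqP.
by apply: etrans (dE k) _; rewrite kN.
Qed.

End l1_facts.

(** * Matrices in the tensor square of l1 *)

Local Notation coord n := (pairing n.+1 (delta _ n)).

Section tensor_evaluation.
Variables (R : realType) (n : nat) (X : lmodType R).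
Implicit Types (u v : tensor n X) (b : mform n X).

Lemma tensor_bigE I (r : seq I) (P : pred I) (u : I -> tensor n X) b :
  (\sum_(i <- r | P i) u i : tensor n X) b = \sum_(i <- r | P i) u i b.
Proof.
rewrite -[LHS]/(val (\sum_(i <- r | P i) u i) b) raddf_sum/= fct_sumE.
by [].
Qed.

Lemma tensorBE u v b : (u - v) b = u b - v b.
Proof. by []. Qed.

Lemma tensorZE a u b : (a *: u) b = a * u b.
Proof. by []. Qed.

End tensor_evaluation.

Lemma inj_norm_le (R : realType) n (X : normedModType R) (u : tensor n X) M :
  (forall f, (forall i, dual_ball (f i)) -> `|u (form_tensor f)| <= M) ->
  inj_norm u <= M.
Proof.
move=> uM; apply: ge_sup; first exact: inj_set0.
by move=> _ [f f1 <-]; exact: uM.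
Qed.

Lemma lt_inj_norm (R : realType) n (X : normedModType R) (u : tensor n X) M :
  M < inj_norm u -> exists2 f : 'I_n -> {linear X -> R^o},
    forall i, dual_ball (f i) & M < `|u (form_tensor f)|.
Proof. by move=> /(sup_gt (inj_set0 u))[_ [f f1 <-] Mu]; exists f. Qed.

Section matrix_tensors.
Variable R : realType.
Local Notation X := (l1 R).
Local Notation pair2 x y := (fun i : 'I_2 => nth x [:: x; y] i).
Implicit Types (A : nat -> nat -> R) (u : tensor 2 X).

Lemma form_pair2 (T : lmodType R) (f : 'I_2 -> {linear T -> R^o}) x y :
  pure_tensor (pair2 x y) (form_tensor f) = f ord0 x * f ord_max y.
Proof.
rewrite -[LHS]/(\prod_(i < 2) f i (pair2 x y i)) big_ord_recl big_ord1/=.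
by rewrite (_ : lift _ _ = ord_max)//; exact: val_inj.
Qed.

Definition matrix_tensor N A : tensor 2 X :=
  \sum_(p < N) \sum_(q < N) A p q *: pure_tensor (pair2 (unit_vec R p) (unit_vec R q)).

Lemma matrix_tensorE N A f : matrix_tensor N A (form_tensor f) =
  bilin N A (fun p => f ord0 (unit_vec R p)) (fun q => f ord_max (unit_vec R q)).
Proof.
rewrite tensor_bigE; apply: eq_bigr => p _; rewrite tensor_bigE.
by apply: eq_bigr => q _; rewrite tensorZE form_pair2 mulrA.
Qed.

(** The injective norm of a finite matrix is its norm as a bilinear form on
    sequences bounded by 1; this lemma is one half of this fact and
    [lt_matrix_tensor] is the other. *)
Lemma matrix_tensor_bounded N A M :
  inj_norm (matrix_tensor N A) <= M -> bilin_bounded N A M.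
Proof.
move=> AM s t s1 t1.
pose f := pair2 (pairing N s : {linear X -> R^o}) (pairing N t : {linear X -> R^o}).
have f1 i : dual_ball (f i).
  by case: i => -[|[|//]] ?; exact: dual_ball_pairing.
have := le_trans (inj_norm_ge (matrix_tensor N A) f1) AM.
rewrite matrix_tensorE; congr (`|_| <= _).
by apply: eq_bigr => p _; apply: eq_bigr => q _; rewrite /f/= !pairing_unit_vec.
Qed.

Lemma lt_matrix_tensor N A M : M < inj_norm (matrix_tensor N A) ->
  exists s t, [/\ forall p, `|s p| <= 1, forall q, `|t q| <= 1 &
    M <= `|bilin N A s t|].
Proof.
move=> /lt_inj_norm[f f1]; rewrite matrix_tensorE => /ltW Mf.
exists (fun p => f ord0 (unit_vec R p)), (fun q => f ord_max (unit_vec R q)).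
by split=> // p; exact: dual_ball_unit_vec.
Qed.

Lemma matrix_tensor_sum N I (r : seq I) (A : I -> nat -> nat -> R) :
  matrix_tensor N (fun p q => \sum_(i <- r) A i p q) =
  \sum_(i <- r) matrix_tensor N (A i).
Proof.
rewrite exchange_big; apply: eq_bigr => p _; rewrite exchange_big.
by apply: eq_bigr => q _ /=; rewrite scaler_suml.
Qed.

Lemma matrix_tensorB N A A' :
  matrix_tensor N (fun p q => A p q - A' p q) =
  matrix_tensor N A - matrix_tensor N A'.
Proof.
rewrite -sumrB; apply: eq_bigr => p _; rewrite -sumrB.
by apply: eq_bigr => q _; rewrite scalerBl.
Qed.

Definition supported N A := forall p q, ~~ ((p < N) && (q < N))%N -> A p q = 0.

Lemma matrix_tensor_widen N N' A : supported N A -> (N <= N')%N ->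
  matrix_tensor N' A = matrix_tensor N A.
Proof.
move=> As NN; rewrite /matrix_tensor.
set F := fun p q => A p q *: pure_tensor (pair2 (unit_vec R p) (unit_vec R q)).
have F0 p q : ~~ ((p < N) && (q < N))%N -> F p q = 0.
  by move=> /As; rewrite /F => ->; rewrite scale0r.
rewrite [RHS](big_ord_widen N' (fun p => \sum_(q < N) F p q) NN).
rewrite [RHS]big_mkcond; apply: eq_bigr => p _ /=; case: ifPn => pN; last first.
  by rewrite big1// => q _; rewrite -/(F p q) F0// (negbTE pN).
rewrite (big_ord_widen N' (F p) NN) [RHS]big_mkcond; apply: eq_bigr => q _ /=.
by case: ifPn => qN //; rewrite -/(F p q) F0// (negbTE qN) andbF.
Qed.

Definition coef u p q : R :=
  u (form_tensor (pair2 (coord p : {linear X -> R^o}) (coord q : {linear X -> R^o}))).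

(** Asking for all large N makes the property stable under sums. *)
Definition matrix_approx u := forall e, 0 < e -> exists N0, forall N, (N0 <= N)%N ->
  inj_norm (u - matrix_tensor N (coef u)) <= e.

Lemma matrix_approx0 : matrix_approx 0.
Proof.
move=> e e0; exists 0%N => N _; apply: inj_norm_le => f f1.
rewrite tensorBE matrix_tensorE /bilin big1 ?subrr ?normr0 ?ltW// => p _.
by rewrite big1// => q _; rewrite !mul0r.
Qed.

Lemma matrix_approxZD a u v : matrix_approx u -> matrix_approx v ->
  matrix_approx (a *: u + v).
Proof.
move=> uA vA e e0; have a1 : 0 < `|a| + 1 by rewrite ltr_wpDl.
have [N0 uN] := uA (e / 2 / (`|a| + 1)) (divr_gt0 (divr_gt0 e0 (ltr0Sn _ 1)) a1).
have [N1 vN] := vA (e / 2) (divr_gt0 e0 (ltr0Sn _ 1)).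
exists (maxn N0 N1) => N; rewrite geq_max => /andP[/uN uN' /vN vN'].
have -> : a *: u + v - matrix_tensor N (coef (a *: u + v)) =
    a *: (u - matrix_tensor N (coef u)) + (v - matrix_tensor N (coef v)).
  rewrite scalerBr addrACA -opprD; congr (_ - _).
  rewrite /matrix_tensor scaler_sumr -big_split; apply: eq_bigr => p _ /=.
  rewrite scaler_sumr -big_split; apply: eq_bigr => q _ /=.
  by rewrite scalerA -scalerDl.
apply: le_trans (inj_normD _ _) _; rewrite inj_normZ [leRHS](splitr e) lerD//.
apply: (@le_trans _ _ ((`|a| + 1) * inj_norm (u - matrix_tensor N (coef u)))).
  by rewrite ler_wpM2r// ?lerDl//; exact: (seminorm_ge0 (inj_seminorm 2 X)).
by rewrite mulrC -ler_pdivlMr.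
Qed.

(** The matrix of x (x) y cut at N is (trunc N x) (x) (trunc N y), and the
    injective norm is at most the product of the norms. *)
Lemma matrix_approx_pure (z : 'I_2 -> X) : matrix_approx (pure_tensor z).
Proof.
pose x := z ord0; pose y := z ord_max.
have zE f : pure_tensor z (form_tensor f) = f ord0 x * f ord_max y.
  rewrite -[LHS]/(\prod_(i < 2) f i (z i)) big_ord_recl big_ord1/=.
  by rewrite (_ : lift _ _ = ord_max)//; exact: val_inj.
have cE p q : coef (pure_tensor z) p q = x p * y q by rewrite /coef zE /= !coordE.
move=> e e0; set K := `|x| + `|y| + 1.
have K0 : 0 < K by rewrite ltr_wpDl// addr_ge0.
pose d := Num.min 1 (e / K).
have d0 : 0 < d by rewrite lt_min ltr01 divr_gt0.
have [N0 xN] := trunc_cvg x d0; have [N1 yN] := trunc_cvg y d0.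
exists (maxn N0 N1) => N; rewrite geq_max => /andP[/xN {}xN /yN {}yN].
apply: inj_norm_le => f f1; rewrite tensorBE matrix_tensorE zE.
have -> : bilin N (coef (pure_tensor z)) (fun p => f ord0 (unit_vec R p))
     (fun q => f ord_max (unit_vec R q)) = f ord0 (trunc N x) * f ord_max (trunc N y).
  rewrite !linear_sum mulr_suml; apply: eq_bigr => p _.
  rewrite mulr_sumr; apply: eq_bigr => q _.
  rewrite cE !linearZ/=.
  by rewrite /GRing.scale/=; ring.
have -> : f ord0 x * f ord_max y - f ord0 (trunc N x) * f ord_max (trunc N y) =
   f ord0 (x - trunc N x) * f ord_max y +
   (f ord0 x - f ord0 (x - trunc N x)) * f ord_max (y - trunc N y).
  by rewrite !linearB/=; ring.
have fx : `|f ord0 x| <= `|x| := dual_ball_le _ (f1 _).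
have fy : `|f ord_max y| <= `|y| := dual_ball_le _ (f1 _).
have dx : `|f ord0 (x - trunc N x)| <= d := le_trans (dual_ball_le _ (f1 _)) xN.
have dy : `|f ord_max (y - trunc N y)| <= d := le_trans (dual_ball_le _ (f1 _)) yN.
apply: (@le_trans _ _ (d * K)); last first.
  by rewrite -ler_pdivlMr// ge_min lexx orbT.
have d1 : d <= 1 by rewrite ge_min lexx.
apply: le_trans (ler_normD _ _) _; rewrite !normrM.
rewrite (_ : d * K = d * `|y| + (`|x| + 1) * d); last by rewrite /K; ring.
apply: lerD; apply: ler_pM => //.
by apply: le_trans (ler_normB _ _) _; rewrite lerD// (le_trans dx).
Qed.

Lemma tensor_matrix_approx u e : 0 < e -> exists N0 A, supported N0 A /\
  forall N, (N0 <= N)%N -> inj_norm (u - matrix_tensor N A) <= e.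
Proof.
move=> e0; have : matrix_approx u.
  have [s ->] := tensorP u; elim: s => [|t s IH].
    by rewrite big_nil; exact: matrix_approx0.
  by rewrite big_cons; apply: matrix_approxZD => //; exact: matrix_approx_pure.
move=> /(_ e e0)[N0 uN]; pose A p q := if ((p < N0) && (q < N0))%N then coef u p q else 0.
have As : supported N0 A by move=> p q /negbTE h; rewrite /A h.
exists N0, A; split=> // N NN; rewrite (matrix_tensor_widen As NN).
rewrite (_ : matrix_tensor N0 A = matrix_tensor N0 (coef u)); first exact: uN.
apply: eq_bigr => p _; apply: eq_bigr => q _.
by rewrite /A !ltn_ord.
Qed.

End matrix_tensors.

(** * A lower estimate in the tensor square *)

Section lower_estimate.
Variable R : realType.
Local Notation E := (inj_tensor 2 (l1 R)).

(** Round the numbers a n i down to multiples of e. *)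
Lemma pigeonhole_close (I : finType) (a : nat -> I -> R) M e :
  0 < e -> (forall n i, `|a n i| <= M) ->
  exists n m : nat, n != m /\ forall i, `|a n i - a m i| <= e.
Proof.
move=> e0 aM; set K := Num.truncn (2 * M / e).
pose t n i := Num.truncn ((a n i + M) / e).
have am0 n i : 0 <= (a n i + M) / e.
  by rewrite divr_ge0 ?(ltW e0)//; have /ler_normlP[h1 h2] := aM n i; lra.
have tK n i : (t n i < K.+1)%N.
  rewrite ltnS le_truncn// ler_pM2r ?invr_gt0//.
  by have /ler_normlP[h1 h2] := aM n i; lra.
pose F (n : 'I_#|{: {ffun I -> 'I_K.+1}}|.+1) : {ffun I -> 'I_K.+1} :=
  [ffun i => Ordinal (tK n i)].
have : ~ injective F by move=> /leq_card; rewrite card_ord ltnn.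
move=> nF; apply: contrapT => nex; apply: nF => n m Fnm; apply/val_inj/eqP.
apply: contrapT => /negP nm; apply: nex; exists (val n), (val m); split=> // i.
have tE : t n i = t m i.
  by move/ffunP : Fnm => /(_ i); rewrite !ffunE => /(congr1 val).
have /andP[] := truncn_itv (am0 n i); have /andP[] := truncn_itv (am0 m i).
rewrite -/(t n i) -/(t m i) tE -natr1 ler_pdivlMr// ler_pdivlMr//.
rewrite ltr_pdivrMr// ltr_pdivrMr// => h1 h2 h3 h4.
by apply/ler_normlP; split; lra.
Qed.

Lemma completion_matrix_approx (z : E) e : 0 < e -> exists N0 A, supported N0 A /\
  forall N, (N0 <= N)%N -> `|z - to_completion _ (matrix_tensor N A)| <= e.
Proof.
move=> e0; have e2 : 0 < e / 2 by rewrite divr_gt0.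
have [u zu] := to_completion_approx z e2.
have [N0 [A [As uA]]] := tensor_matrix_approx u e2.
exists N0, A; split=> // N NN.
have -> : z - to_completion _ (matrix_tensor N A) =
    (z - to_completion _ u) + to_completion _ (u - matrix_tensor N A).
  by rewrite linearB addrA subrK.
apply: le_trans (ler_normD _ _) _; rewrite norm_to_completion [leRHS]splitr.
by rewrite lerD ?(ltW zu)// uA.
Qed.

Lemma bilin_delta N (A : nat -> nat -> R) p q : (p < N)%N -> (q < N)%N ->
  bilin N A (delta R p) (delta R q) = A p q.
Proof.
move=> pN qN; rewrite /bilin (bigD1 (Ordinal pN))//= (bigD1 (Ordinal qN))//=.
have d (i : 'I_N) (r : nat) (rN : (r < N)%N) : i != Ordinal rN -> delta R r i = 0.
  by move=> ir; rewrite /delta (_ : (i : nat) == r = false)//; exact: negbTE.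
rewrite /delta !eqxx !mulr1 big1 ?addr0 => [|i /d]; last by rewrite /delta => ->; rewrite mulr0.
rewrite big1 ?addr0// => i /d ip; rewrite big1// => j _.
by move: ip; rewrite /delta => ->; rewrite mulr0 mul0r.
Qed.

(** A bounded sequence of matrices has bounded entries, so the pigeonhole
    principle finds two of them that almost agree on [0,N)^2. *)
Lemma exists_block (z : nat -> E) C eta N : (forall n, `|z n| <= C) -> 0 < eta ->
  exists t : nat * nat * nat * (nat -> nat -> R),
  let: (n, m, N', B) := t in
  [/\ n != m, (N <= N')%N, supported N' B,
    forall N'', (N' <= N'')%N ->
      `|z n - z m - to_completion _ (matrix_tensor N'' B)| <= eta &
    \sum_(p < N) \sum_(q < N) `|B p q| <= eta].
Proof.
move=> zC eta0; have eta2 : 0 < eta / 2 by rewrite divr_gt0.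
have /choice[N0 /choice[A zA]] (n : nat) := completion_matrix_approx (z n) eta2.
have AC n p q : `|A n p q| <= C + eta.
  have [As zn] := zA n.
  have : bilin_bounded (N0 n) (A n) (C + eta).
    apply: matrix_tensor_bounded; rewrite -[leLHS](norm_to_completion (inj_seminorm 2 _)).
    have -> : to_completion (inj_seminorm 2 _) (matrix_tensor (N0 n) (A n)) =
        z n - (z n - to_completion _ (matrix_tensor (N0 n) (A n))).
      by rewrite opprB addrC subrK.
    apply: le_trans (ler_normB _ _) _; rewrite lerD//.
    by apply: le_trans (zn _ (leqnn _)) _; rewrite ler_pdivrMr//; lra.
  move=> /(_ (delta R p) (delta R q) (normr_delta _ _) (normr_delta _ _)).
  have [pq|/As ->] := boolP ((p < N0 n) && (q < N0 n))%N.
    by case/andP: pq => ? ?; rewrite bilin_delta.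
  by rewrite normr0; apply: le_trans; exact: normr_ge0.
pose e := eta / (N * N).+1%:R.
have e0 : 0 < e by rewrite divr_gt0.
have [n [m [nm close]]] := pigeonhole_close
  (a := fun n (x : 'I_N * 'I_N) => A n x.1 x.2) e0 (fun n x => AC n _ _).
pose N' := maxn N (maxn (N0 n) (N0 m)).
exists (n, m, N', fun p q => A n p q - A m p q); split=> //.
- by rewrite leq_maxl.
- move=> p q out; have [An _] := zA n; have [Am _] := zA m.
  by rewrite An ?Am ?subrr//; apply: contra out => /andP[];
    rewrite !leq_max => -> ->; rewrite ?orbT.
- move=> N''; rewrite !geq_max => /and3P[_ Nn Nm].
  rewrite matrix_tensorB linearB/= [X in `|X|](_ : _ =
    (z n - to_completion _ (matrix_tensor N'' (A n))) -
    (z m - to_completion _ (matrix_tensor N'' (A m)))); last first.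
    by rewrite opprD addrACA -opprD.
  have [_ /(_ _ Nn) hn] := zA n; have [_ /(_ _ Nm) hm] := zA m.
  by apply: le_trans (ler_normB _ _) _; rewrite [leRHS]splitr lerD.
- apply: (@le_trans _ _ (\sum_(p < N) \sum_(q < N) e)).
    by apply: ler_sum => p _; apply: ler_sum => q _; exact: (close (p, q)).
  under eq_bigr do rewrite sumr_const card_ord.
  rewrite sumr_const card_ord -mulrnA -mulr_natr /e mulrAC ler_pdivrMr//.
  by rewrite ler_pM2l// ler_nat.
Qed.

(** The differences are chosen one after the other, the box of the j-th step
    containing the supports of the matrices that approximate the earlier
    ones. *)
Lemma sqrt_lower_estimate (k : nat) (z : nat -> nat -> E) C d : 0 < d ->
  (forall j n, `|z j n| <= C) ->
  (forall j n m, n != m -> d <= `|z j n - z j m|) ->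
  exists n m : nat -> nat, (forall j, n j != m j) /\
    k%:R * d <= 8 * Num.sqrt k%:R * `|\sum_(j < k) (z j (n j) - z j (m j))|.
Proof.
move=> d0 zC zd.
(* eta is chosen so that all errors add up to half of k d. *)
pose D := 4 * Num.sqrt k%:R + (1 + 2 * k%:R) + 2 : R.
have D0 : 0 < D by rewrite ltr_wpDl// !addr_ge0 ?mulr_ge0.
pose eta := d / 2 / D.
have eta0 : 0 < eta by rewrite !divr_gt0.
have /choice[g gP] (jN : nat * nat) := exists_block jN.2 (zC jN.1) eta0.
pose N_ := fix N_ j := if j is i.+1 then (g (i, N_ i)).1.2 else 0%N.
pose n j := (g (j, N_ j)).1.1.1; pose m j := (g (j, N_ j)).1.1.2.
pose B j := (g (j, N_ j)).2.
have P j : [/\ n j != m j, (N_ j <= N_ j.+1)%N, supported (N_ j.+1) (B j),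
    forall N'', (N_ j.+1 <= N'')%N ->
      `|z j (n j) - z j (m j) - to_completion _ (matrix_tensor N'' (B j))| <= eta &
    \sum_(p < N_ j) \sum_(q < N_ j) `|B j p q| <= eta].
  have := gP (j, N_ j); rewrite /n /m /B /=.
  by case: (g (j, N_ j)) => [[[? ?] ?] ?].
have Nh : {homo N_ : i j / (i <= j)%N}.
  by apply: homo_leq => // [i j l|i]; [exact: leq_trans|have [] := P i].
exists n, m; split=> [j|]; first by have [] := P j.
set M := `|\sum_(j < k) _|.
have close (j : 'I_k) :
    `|z j (n j) - z j (m j) - to_completion _ (matrix_tensor (N_ k) (B j))| <= eta.
  by have [_ _ _ + _] := P j; apply; exact: Nh.
have SM : bilin_bounded (N_ k) (fun p q => \sum_(j < k) B j p q) (M + k%:R * eta).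
  apply: matrix_tensor_bounded; rewrite matrix_tensor_sum.
  rewrite -[leLHS](norm_to_completion (inj_seminorm 2 _)) linear_sum/=.
  rewrite [X in `|X|](_ : _ = \sum_(j < k) (z j (n j) - z j (m j)) -
    \sum_(j < k) (z j (n j) - z j (m j) -
       to_completion _ (matrix_tensor (N_ k) (B j)))); last first.
    by rewrite [X in _ - X]sumrB opprB addrC subrK.
  apply: le_trans (ler_normB _ _) _; rewrite lerD2l.
  apply: le_trans (ler_norm_sum _ _ _) _.
  apply: le_trans (ler_sum _ (fun j _ => close j)) _.
  by rewrite sumr_const card_ord mulr_natl.
have low j : (j < k)%N -> exists s t, [/\ forall p, `|s p| <= 1,
     forall q, `|t q| <= 1 & d - 2 * eta <= `|bilin (N_ k) (B j) s t|].
  move=> jk; apply: lt_matrix_tensor.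
  rewrite -[ltRHS](norm_to_completion (inj_seminorm 2 _)).
  have := close (Ordinal jk) => /=; have [nm _ _ _ _] := P j.
  have := zd j _ _ nm; set w := z j (n j) - z j (m j) => dw.
  move=> /(le_trans (lerB_dist _ _)); lra.
have := sum_blocks_lower Nh _ _ (ltW eta0) SM low.
have etaD : eta * D = d / 2 by rewrite /eta divfK// gt_eqF.
move=> /(_ (fun j => let: And5 _ _ Bs _ _ := P j in Bs)).
move=> /(_ (fun j _ => let: And5 _ _ _ _ Bb := P j in Bb)).
have -> : 4 * Num.sqrt k%:R * (M + k%:R * eta) + k%:R * (1 + 2 * k%:R) * eta =
  4 * Num.sqrt k%:R * M + k%:R * (eta * D) - 2 * k%:R * eta by rewrite /D; ring.
by rewrite etaD; lra.
Qed.

End lower_estimate.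

(** * Rademacher tensors in the tensor cube *)

Section rademacher_tensors.
Variables (R : realType) (k : nat).
Local Notation X := (l1 R).
Local Notation signs := {ffun 'I_k -> bool}.
Local Notation L := #|{: signs}|.
Local Notation triple x y z := (fun i : 'I_3 => nth x [:: x; y; z] i).

(** The j-th Rademacher function as an element of l1: the coordinates are the
    choices of signs, each with weight 2^-k, so that the r_j span l2^k up to a
    constant. *)
Definition rademacher_vec (j : 'I_k) : X :=
  L%:R^-1 *: \sum_(w : signs) rademacher R j w *: unit_vec R (enum_rank w).

Lemma linear_rademacher_vec (f : {linear X -> R^o}) j : f (rademacher_vec j) =
  L%:R^-1 * \sum_(w : signs) rademacher R j w * f (unit_vec R (enum_rank w)).
Proof.
rewrite /rademacher_vec linearZ/= linear_sum/=; congr (_ * _).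
by apply: eq_bigr => w _; rewrite linearZ.
Qed.

(** A norming functional of [rademacher_vec j]. *)
Definition sign_seq (j : 'I_k) (p : nat) : R :=
  oapp (fun i : 'I_L => rademacher R j (enum_val i)) 0 (insub p).

Lemma normr_sign_seq j p : `|sign_seq j p| <= 1.
Proof.
by rewrite /sign_seq; case: insub => [i|]/=; rewrite ?normr0 ?normr_rademacher.
Qed.

Lemma pairing_rademacher_vec j : pairing L (sign_seq j) (rademacher_vec j) = 1.
Proof.
rewrite linear_rademacher_vec; under eq_bigr => w _.
  rewrite /= pairing_unit_vec// /sign_seq valK/= enum_rankK -expr2 rademacher_sqr.
  over.
rewrite sumr_const mulVf// pnatr_eq0 -lt0n; apply/card_gt0P.
by exists [ffun=> true].
Qed.

Definition test_tensor j n : tensor 3 X :=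
  pure_tensor (triple (rademacher_vec j) (rademacher_vec j) (unit_vec R n)).

Lemma form_test_tensor (f : 'I_3 -> {linear X -> R^o}) j n :
  test_tensor j n (form_tensor f) =
  f ord0 (rademacher_vec j) * f (lift ord0 ord0) (rademacher_vec j) *
  f ord_max (unit_vec R n).
Proof.
rewrite -[LHS]/(\prod_(i < 3) f i (triple _ _ _ i)) !big_ord_recl big_ord0/=.
rewrite mulr1 mulrA (_ : lift _ (lift _ _) = ord_max)//; exact: val_inj.
Qed.

Lemma test_tensor_separated j n m : n != m ->
  1 <= inj_norm (test_tensor j n - test_tensor j m).
Proof.
move=> nm.
pose f : 'I_3 -> {linear X -> R^o} := triple
  (pairing L (sign_seq j) : {linear X -> R^o})
  (pairing L (sign_seq j) : {linear X -> R^o}) (coord n : {linear X -> R^o}).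
have f1 i : dual_ball (f i).
  case: i => -[|[|[|//]]] ?; apply: dual_ball_pairing => p;
    by [exact: normr_sign_seq | exact: normr_delta].
apply: le_trans (inj_norm_ge _ f1); rewrite tensorBE !form_test_tensor /f/=.
rewrite !pairing_rademacher_vec !coord_unit_vec eqxx (negbTE nm).
by rewrite !mul1r subr0 normr1.
Qed.

(** f (r_j) is the j-th Rademacher coefficient of the function w |-> f (e_w),
    which is bounded by 1. *)
Lemma sum_rademacher_vec_sqr (f : {linear X -> R^o}) : dual_ball f ->
  \sum_(j < k) f (rademacher_vec j) ^+ 2 <= 1.
Proof.
move=> f1; under eq_bigr do rewrite linear_rademacher_vec.
by apply: bessel => w; exact: dual_ball_unit_vec.
Qed.

Lemma inj_norm_test_tensor j n : inj_norm (test_tensor j n) <= 1.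
Proof.
have le1 (f : {linear X -> R^o}) : dual_ball f -> `|f (rademacher_vec j)| <= 1.
  move=> f1; rewrite -(@expr_le1 _ 2)// real_normK ?num_real//.
  apply: le_trans (sum_rademacher_vec_sqr f1).
  by rewrite (bigD1 j)//= lerDl sumr_ge0// => i _; exact: sqr_ge0.
apply: inj_norm_le => f f1; rewrite form_test_tensor !normrM.
by rewrite !mulr_ile1 ?mulr_ge0 ?le1// dual_ball_unit_vec.
Qed.

(** The third factor contributes at most 2 and the first two are estimated by
    |a b| <= (a^2 + b^2) / 2. *)
Lemma sum_test_tensor_le (n m : 'I_k -> nat) :
  inj_norm (\sum_j (test_tensor j (n j) - test_tensor j (m j))) <= 2.
Proof.
apply: inj_norm_le => f f1; rewrite tensor_bigE.
pose a j := f ord0 (rademacher_vec j) : R.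
pose b j := f (lift ord0 ord0) (rademacher_vec j) : R.
apply: le_trans (ler_norm_sum _ _ _) _.
apply: (@le_trans _ _ (\sum_j (a j ^+ 2 + b j ^+ 2))); last first.
  by rewrite big_split -[leRHS]/(1 + 1) lerD ?sum_rademacher_vec_sqr.
apply: ler_sum => j _; rewrite tensorBE !form_test_tensor -/(a j) -/(b j) -mulrBr.
set c := _ - _ : R; rewrite !normrM.
have c2 : `|c| <= 2.
  by apply: le_trans (ler_normB _ _) _; rewrite -[leRHS]/(1 + 1) lerD ?dual_ball_unit_vec.
apply: le_trans (ler_wpM2l _ c2) _; first by rewrite mulr_ge0.
rewrite -(real_normK (num_real (a j))) -(real_normK (num_real (b j))).
rewrite -subr_ge0; have -> : `|a j| ^+ 2 + `|b j| ^+ 2 - `|a j| * `|b j| * 2 =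
  (`|a j| - `|b j|) ^+ 2 by ring.
exact: sqr_ge0.
Qed.

End rademacher_tensors.

Lemma continuous_linear_le (R : realType) (V W : normedModType R) (T : {linear V -> W}) :
  continuous T -> exists2 K, 0 < K & forall x, `|T x| <= K * `|x|.
Proof.
move=> /linear_bounded_continuous/linear_boundedP[K [_ TK]].
exists (Num.max K 0 + 1); first by rewrite ltr_pwDr// le_max lexx orbT.
by move=> x; apply: TK; rewrite ltr_pwDr// le_max lexx.
Qed.

(** By continuity of S at 0 on the range, |T x| < d forces |x| < 1. *)
Lemma bounded_below_of_left_inverse (R : realType) (V W : normedModType R)
    (T : {linear V -> W}) (S : W -> V) : cancel T S ->
  {within range T, continuous S}%classic ->
  exists2 d : R, 0 < d & forall x, 1 <= `|x| -> d <= `|T x|.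
Proof.
move=> TS /subspace_continuousP/(_ (T 0) (ex_intro2 _ _ 0 I erefl)).
rewrite [from_subspace _ _ _]TS => /cvgr0Pnorm_lt/(_ 1 ltr01).
rewrite near_withinE linear0.
move=> /nbhs_norm0P[e /= e0 eS]; exists e => // x x1.
rewrite leNgt; apply/negP => Txe; move: x1; rewrite leNgt => /negP; apply.
by rewrite -[X in `|X|]TS; apply: eS => //; exists x.
Qed.

Theorem theorem1p3 (R : realType) :
  ~ isomorphic_to_subspace (inj_tensor 3 (l1 R)) (inj_tensor 2 (l1 R)).
Proof.
move=> [T [Tc [S TS Sc]]].
have [K K0 TK] := continuous_linear_le Tc.
have [d d0 Td] := bounded_below_of_left_inverse TS Sc.
(* With k = m^2 the lower estimate reads m d <= 16 K. *)
pose m := (Num.truncn (16 * K / d)).+1.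
have mK : 16 * K < m%:R * d.
  by rewrite -ltr_pdivrMr// truncnS_gt.
pose k := (m ^ 2)%N; have kE : k = k.-1.+1 by rewrite /k expnS.
pose z j n : inj_tensor 2 (l1 R) :=
  T (to_completion _ (test_tensor R (inord j : 'I_k.-1.+1) n)).
have zK j n : `|z j n| <= K.
  apply: le_trans (TK _) _; rewrite norm_to_completion.
  by rewrite ler_piMr ?(ltW K0)//; exact: inj_norm_test_tensor.
have zd j n p : n != p -> d <= `|z j n - z j p|.
  move=> np; rewrite -linearB; apply: Td; rewrite -linearB norm_to_completion.
  exact: test_tensor_separated.
have [a [b [_]]] := sqrt_lower_estimate k.-1.+1 d0 zK zd.
have -> : \sum_(j < k.-1.+1) (z j (a j) - z j (b j)) =
    T (to_completion _ (\sum_(j < k.-1.+1)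
      (test_tensor R j (a j) - test_tensor R j (b j)))).
  rewrite !linear_sum; apply: eq_bigr => j _.
  by rewrite !linearB /z !inord_val.
have := sum_test_tensor_le R (fun j : 'I_k.-1.+1 => a j) (fun j => b j).
set u := \sum_(j < _) _ => u2.
have {}u2 : `|T (to_completion _ u)| <= K * 2.
  by apply: le_trans (TK _) _; rewrite ler_wpM2l ?(ltW K0)// norm_to_completion.
rewrite -kE /k natrX sqrtr_sqr ger0_norm// => h.
have m0 : 0 < m%:R :> R by rewrite ltr0n.
have := le_trans h (ler_wpM2l _ u2); rewrite mulr_ge0// => /(_ isT).
rewrite expr2 -!mulrA (mulrCA 8) ler_pM2l// => /(lt_le_trans mK); lra.
Qed.
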